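(* Let $G$ be a finite solvable group and suppose that $A$ is a core-free mt-stabilizer in $G$ of square-free index $n=|G:A|$. Let $F$ be the Fitting subgroup of $G$. Then $|F|$ is coprime to $|G:F|$ and all Sylow subgroups of $F$ are elementary abelian. In particular, $G$ is nilpotent if and only if $G$ is cyclic of order $n$, with $A=1$. Moreover, let $\pi^*=\pi(n)\setminus\pi(F)$ and let $n^*$ be the product of the primes in $\pi^*$. If $C$ is a Hall $\pi^*$-subgroup of $A$ and $Q$ is a Hall $\pi^*$-subgroup of $G$ containing $C$, then $|Q:C|=n^*$ and the action of $Q$ on $Q:C$ is permutationally equivalent to the action of $G$ on $G:AF$.
   Context: For a subgroup $A$ of a finite group $G$, $G:A$ denotes the set of cosets of $A$ in $G$ with the natural transitive action of $G$; its kernel is the core $K_{G:A}=\bigcap_{g\in G}A^g$. $A$ is core-free if $K_{G:A}=1$. The subgroup $A$ is an mt-stabilizer in $G$ (equivalently, $G$ acts minimally transitively on $G:A$) if every subgroup $H$ with $K_{G:A}\subseteq H\subsetneq G$ acts intransitively on $G:A$; that is, whenever a subgroup $H\subseteq G$ is transitive on $G:A$, then $HK_{G:A}=G$. For an integer $n$, $\pi(n)$ is the set of primes dividing $n$, and $\pi(F)=\pi(|F|)$. Two (not necessarily faithful) actions, of $Q$ on $X$ and of $G$ on $Y$, are permutationally equivalent if there is a bijection $X\to Y$ carrying the permutation group induced by $Q$ on $X$ onto the permutation group induced by $G$ on $Y$. *)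

(* Defs.v *)
From mathcomp Require Import all_boot all_fingroup all_solvable.

Set Implicit Arguments.
Unset Strict Implicit.
Unset Printing Implicit Defensive.

Import GroupScope.

Definition squarefree (n : nat) : Prop :=
  (0 < n)%N /\ forall p : nat, prime p -> ~~ (p ^ 2 %| n)%N.

(* The coset space G : A is the set of right cosets [rcosets A G], acted on by
   right translation ['Rs]; its kernel is [gcore A G]. *)
Definition mt_stabilizer (gT : finGroupType) (G A : {group gT}) : Prop :=
  forall H : {group gT}, gcore A G \subset H -> H \proper G ->
    ~~ [transitive H, on rcosets A G | 'Rs].

(* The carriers [X] and [Y] lie in one finType, so every bijection from [X]
   onto [Y] is the restriction of a total function [f : T -> T]. The last two
   clauses say that conjugation by [f] maps the set of permutations of [X]
   induced by [Q] onto the set of permutations of [Y] induced by [G]. *)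
Definition perm_equivalent (aT1 aT2 : finGroupType) (T : finType)
    (D1 : {set aT1}) (D2 : {set aT2})
    (to1 : action D1 T) (Q : {set aT1}) (X : {set T})
    (to2 : action D2 T) (G : {set aT2}) (Y : {set T}) : Prop :=
  exists f : T -> T,
    [/\ {in X &, injective f},
        f @: X = Y,
        forall q, q \in Q ->
          exists2 g, g \in G & {in X, forall x, f (to1 x q) = to2 (f x) g}
      & forall g, g \in G ->
          exists2 q, q \in Q & {in X, forall x, f (to1 x q) = to2 (f x) g}].

Definition pi_star (n m : nat) : nat_pred :=
  [pred p | (p \in \pi(n)) && (p \notin \pi(m))].

Definition n_star (n m : nat) : nat :=
  (\prod_(p <- primes n | p \in pi_star n m) p)%N.

(* Main.v *)
Require Import Defs.
From mathcomp Require Import all_boot all_fingroup all_solvable.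

Set Implicit Arguments.
Unset Strict Implicit.
Unset Printing Implicit Defensive.

Import GroupScope.

(** Since [A] is core-free, minimal transitivity says that [A] has no proper
    supplement in [G]: [A * H = G] forces [H = G]. Square-freeness of [#|G : A|]
    makes normal [p]-subgroups nearly lie in [A]: a nontrivial [N <| G] of
    [p]-power order is not contained in [A], and [#|N : N :&: A|] is a power of
    [p] that divides [#|G : A|], so it is exactly [p].

    For [P = 'O_p(G)], the intersection [P :&: A] is then maximal in [P], so
    the Frattini subgroup of [P], which is normal in [G], lies in [A] and must
    be trivial: [P] is elementary abelian ([pcore_abelem]). Moreover [A P] has
    index [#|G : A| %/ p] in [G], prime to [p], so a Hall [p^']-subgroup [H]
    supplements it: [A (P H) = G]. Hence [P H = G] and [P] is a Sylow subgroup
    ([pcore_pHall]). Letting [p] run over the primes of ['F(G)], the Fitting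
    subgroup is a Hall subgroup of [G].

    For the action, [A 'F(G)] has index a [pi_star]-number, so the Hall subgroup
    [Q] supplements it: [A ('F(G) Q) = G], whence ['F(G) Q = G]
    ([mulG_Fitting_Hall]). As ['F(G)] acts trivially on the cosets of
    [A 'F(G)], the groups [Q] and [G] induce the same permutations there; and
    [C] is the stabilizer of a point for [Q], because [C] is already a Hall
    [pi_star]-subgroup of [A 'F(G)]. *)


(** * Square-free numbers *)

Lemma squarefree_logn (n p : nat) : squarefree n -> (logn p n <= 1)%N.
Proof.
case=> n_gt0 sqf_n; have [pr_p | npr_p] := boolP (prime p); last first.
  by rewrite lognE (negPf npr_p).
by rewrite leqNgt -pfactor_dvdn ?sqf_n.
Qed.

Lemma squarefree_partn (n : nat) (pi : nat_pred) :
  squarefree n -> (n`_pi)%N = (\prod_(p <- primes n | p \in pi) p)%N.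
Proof.
move=> sqf_n; rewrite [LHS]prod_prime_decomp // prime_decompE big_map.
rewrite -[RHS]big_filter -primes_part big_seq [RHS]big_seq.
apply: eq_bigr => p /=; rewrite -logn_gt0 => n_p.
suffices ->: logn p (n`_pi)%N = 1%N by [].
apply/eqP; rewrite eqn_leq n_p andbT.
apply: leq_trans (squarefree_logn p sqf_n).
by rewrite dvdn_leq_log ?dvdn_part ?sqf_n.1.
Qed.

Lemma squarefree_pnat (n p m : nat) :
  squarefree n -> prime p -> p.-nat m -> m != 1%N -> m %| n -> m = p.
Proof.
move=> sqf_n pr_p /p_natP[[|k] ->] // _ dv_m.
have := leq_trans (dvdn_leq_log p sqf_n.1 dv_m) (squarefree_logn p sqf_n).
by rewrite pfactorK //; case: k {dv_m}.
Qed.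

(** * Supplements and Hall subgroups *)

Lemma index_joing_norm (gT : finGroupType) (A N : {group gT}) :
  A \subset 'N(N) -> #|A <*> N : A| = #|N : A|.
Proof. by move=> nNA; rewrite norm_joinEl // indexMg. Qed.

(** By Lagrange through [M :&: Q], [#|G : M|] divides [#|G : Q| * #|Q : M|],
    and it is prime to the first factor: [Q] meets every coset of [M]. *)
Lemma mulG_pHall (gT : finGroupType) (pi : nat_pred) (G M Q : {group gT}) :
  M \subset G -> pi.-nat #|G : M| -> pi.-Hall(G) Q -> M * Q = G.
Proof.
move=> sMG piGM /and3P[sQG _ pi'GQ].
apply/eqP; rewrite eqEcard mul_subG //= -(leq_pmul2r (cardG_gt0 (M :&: Q))).
rewrite -mul_cardG -(Lagrange sMG) -mulnA leq_mul2l -(LagrangeI Q M) setIC.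
rewrite mulnC leq_pmul2l ?cardG_gt0 // orbC dvdn_leq ?indexg_gt0 //=.
rewrite -(indexgI Q M) -(@Gauss_dvdr _ #|G : Q|); last exact: pnat_coprime pi'GQ.
by rewrite Lagrange_index ?subsetIl ?indexgS ?subsetIr.
Qed.

(** Minimal transitivity in factorized form: [A * H = G] means that the
    [H]-orbit of the point [A] is the whole coset space. *)
Lemma mt_stabilizer_supplement (gT : finGroupType) (G A H : {group gT}) :
    mt_stabilizer G A -> gcore A G \subset H -> H \subset G ->
  A * H = G -> H :=: G.
Proof.
move=> mtA sKH sHG defG; apply/eqP; apply: contraT => neHG.
have prHG: H \proper G by rewrite properEneq neHG.
case/negP: (mtA H sKH prHG).
suffices defX: orbit 'Rs H A = rcosets A G.
  by apply/imsetP; exists (A : {set gT}); rewrite ?defX // -orbitRs orbit_refl.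
apply/eqP; rewrite eqEsubset imsetS //=; apply/subsetP=> _ /rcosetsP[x Gx ->].
have /mulsgP[a h Aa Hh ->]: x \in A * H by rewrite defG.
by rewrite rcosetM rcoset_id //; apply/orbitP; exists h => //=; rewrite rcosetE.
Qed.

(** * The Fitting subgroup *)

Section SquarefreeIndex.

Variables (gT : finGroupType) (G A : {group gT}).
Hypotheses (sAG : A \subset G) (coreA : gcore A G :=: 1).
Hypothesis sqfA : squarefree #|G : A|.

(** Here [#|N : A|] counts the cosets of [A] that meet [N], so it equals both
    [#|N : N :&: A|] and [#|A <*> N : A|]; the latter is a factor of
    [#|G : A|]. *)
Lemma dvdn_index_normal (N : {group gT}) : N <| G -> #|N : A| %| #|G : A|.
Proof.
case/andP=> sNG nNG; rewrite -index_joing_norm ?(subset_trans sAG) //.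
rewrite -(@Lagrange_index _ G (A <*> N)) ?dvdn_mull ?joing_subl //.
by rewrite join_subG sAG.
Qed.

(** The index is a power of [p] dividing a square-free number, and it is not 1
    because a core-free [A] contains no nontrivial normal subgroup of [G]. *)
Lemma index_normal_pgroup (p : nat) (N : {group gT}) :
  prime p -> p.-group N -> N <| G -> N :!=: 1 -> #|N : A| = p.
Proof.
move=> pr_p pN nsNG ntN; have [sNG nNG] := andP nsNG.
apply: squarefree_pnat sqfA pr_p _ _ (dvdn_index_normal nsNG).
  exact: pnat_dvd (dvdn_indexg _ _) pN.
apply: contra ntN; rewrite indexg_eq1 => sNA.
by rewrite -subG1 -coreA gcore_max.
Qed.

(** A subgroup of index [p] in the [p]-group ['O_p(G)] contains its Frattini
    subgroup; being normal in [G] and contained in [A], that subgroup is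
    trivial. *)
Lemma pcore_abelem (p : nat) : prime p -> p.-abelem 'O_p(G).
Proof.
move=> pr_p; have pP := pcore_pgroup p G.
have [-> | ntP] := eqVneq 'O_p(G) 1; first exact: abelem1.
have maxPA: maximal ('O_p(G) :&: A) 'O_p(G).
  rewrite (p_index_maximal (subsetIl _ _)) //= indexgI.
  by rewrite (index_normal_pgroup pr_p) ?pcore_normal.
rewrite -trivg_Phi // -subG1 -coreA gcore_max ?gFnorm_trans ?gFnorm //.
by apply: subset_trans (Phi_sub_max maxPA) (subsetIr _ _).
Qed.

Hypotheses (solG : solvable G) (mtA : mt_stabilizer G A).

(** If [H] is a Hall [p^']-subgroup, then ['O_p(G) H] supplements [A]: the index
    of [A 'O_p(G)] is prime to [p] because ['O_p(G)] absorbs the only factor [p]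
    of [#|G : A|]. *)
Lemma pcore_pHall (p : nat) : prime p -> 'O_p(G) != 1 -> p.-Sylow(G) 'O_p(G).
Proof.
move=> pr_p ntP; have nsPG := pcore_normal p G; have [sPG nPG] := andP nsPG.
have [H hallH] := Hall_exists p^' solG; have [sHG p'H _] := and3P hallH.
have nPH := subset_trans sHG nPG; have nPA := subset_trans sAG nPG.
have sAPG: A <*> 'O_p(G) \subset G by rewrite join_subG sAG.
have p'GAP: p^'.-nat #|G : A <*> 'O_p(G)|.
  rewrite p'natE //; apply: contra (sqfA.2 p pr_p) => p_dv_GAP.
  rewrite -(Lagrange_index sAPG (joing_subl _ _)) index_joing_norm //.
  by rewrite (@index_normal_pgroup p) ?pcore_pgroup // dvdn_mul.
have defG: 'O_p(G) <*> H = G.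
  apply: mt_stabilizer_supplement mtA _ _ _; rewrite ?coreA ?sub1G //=.
    by rewrite join_subG sPG.
  rewrite norm_joinEr // mulgA -norm_joinEl //.
  exact: mulG_pHall p'GAP hallH.
have iGP: #|G : 'O_p(G)| = #|H : 'O_p(G)|.
  by rewrite -(indexMg _ H) -norm_joinEr // [_ <*> _]defG.
rewrite /pHall sPG pcore_pgroup iGP.
exact: pnat_dvd (dvdn_indexg _ _) p'H.
Qed.

(** Any prime [p] of ['F(G)] gives a nontrivial ['O_p(G) = 'O_p('F(G))], which
    is already a Sylow subgroup of [G]. *)
Lemma Fitting_pHall : \pi('F(G)).-Hall(G) 'F(G).
Proof.
rewrite /pHall Fitting_sub pgroup_pi; apply/pnatP=> // p pr_p p_dv_GF.
apply/negP=> /= piFp.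
have ntP: 'O_p(G) != 1.
  rewrite -p_core_Fitting -cardG_gt1.
  rewrite (card_Hall (nilpotent_pcore_Hall p (Fitting_nil G))).
  by rewrite p_part_gt1.
have /and3P[_ _] := pcore_pHall pr_p ntP.
rewrite p'natE // => /negP[]; apply: dvdn_trans p_dv_GF _.
by rewrite indexgS //= -(p_core_Fitting p G) pcore_sub.
Qed.

Lemma Fitting_Sylow_abelem (p : nat) (P : {group gT}) :
  prime p -> p.-Sylow('F(G)) P -> p.-abelem P.
Proof.
move=> pr_p sylP; have nilF := Fitting_nil G.
by rewrite (nilpotent_Hall_pcore nilF sylP) p_core_Fitting pcore_abelem.
Qed.

(** In a nilpotent group the Sylow subgroups are the ['O_p(G)], here abelian, so
    [G] is abelian and [A], being normal and core-free, is trivial. The order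
    of [G] is then square-free, so its Sylow subgroups are cyclic. *)
Lemma nilpotent_cyclic : nilpotent G -> cyclic G /\ A :=: 1.
Proof.
move=> nilG; have abG: abelian G.
  rewrite /abelian -{1}(Sylow_gen G) gen_subG.
  apply/bigcupsP=> P /SylowP[p pr_p sylP].
  rewrite (nilpotent_Hall_pcore nilG sylP).
  have /dprodP[_ defG cPP' _] := nilpotent_pcoreC p nilG.
  rewrite /= -[X in 'C(X)]defG centM subsetI.
  by rewrite -abelianE (abelem_abelian (pcore_abelem pr_p)) centsC.
have A1: A :=: 1.
  apply/trivgP; rewrite -coreA gcore_max //.
  exact: subset_trans (sub_abelian_norm abG sAG).
split=> //; apply: nil_Zgroup_cyclic (nilG).
apply/forall_inP=> P /SylowP[p pr_p sylP].
have abelP: p.-abelem P.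
  by rewrite (nilpotent_Hall_pcore nilG sylP) pcore_abelem.
rewrite (abelem_cyclic abelP) (card_Hall sylP) p_part pfactorK //.
by have:= squarefree_logn p sqfA; rewrite A1 indexg1.
Qed.

(** * The action of a Hall subgroup on the cosets of [A 'F(G)] *)

Section ComplementAction.

Variables C Q : {group gT}.
Let pis := pi_star #|G : A| #|'F(G)|.
Hypotheses (hallC : pis.-Hall(A) C) (hallQ : pis.-Hall(G) Q).
Hypothesis sCQ : C \subset Q.

(** Compare the [pi_star]-parts of the two factorizations
    [#|G : A| * #|A : C| = #|G : Q| * #|Q : C|]. *)
Lemma index_Hall_pi_star : #|Q : C| = n_star #|G : A| #|'F(G)|.
Proof.
have [sCA _ pi'AC] := and3P hallC; have [sQG piQ pi'GQ] := and3P hallQ.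
have: (#|G : A| * #|A : C| = #|G : Q| * #|Q : C|)%N by rewrite !Lagrange_index.
move/(congr1 (fun m => m`_pis)%N); rewrite !partnM // !(part_p'nat pi'GQ).
have piQC: pis.-nat #|Q : C| by apply: pnat_dvd (dvdn_indexg _ _) piQ.
rewrite (part_p'nat pi'AC) muln1 mul1n (part_pnat_id piQC) => <-.
exact: squarefree_partn.
Qed.

Let nFA : A \subset 'N('F(G)).
Proof. exact: subset_trans sAG (gFnorm _ _). Qed.

Let sMG : A <*> 'F(G) \subset G.
Proof. by rewrite join_subG sAG Fitting_sub. Qed.

Lemma pi_star_index_AF : pis.-nat #|G : A <*> 'F(G)|.
Proof.
have /and3P[_ _ pi'GF] := Fitting_pHall.
apply/pnatP=> // p pr_p p_dv_GM; apply/andP; split.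
  rewrite /= mem_primes pr_p indexg_gt0 (dvdn_trans p_dv_GM) //.
  by rewrite indexgS ?joing_subl.
have: p \in \pi('F(G))^'.
  apply: (pnatP _ (indexg_gt0 G 'F(G)) pi'GF) => //.
  by rewrite (dvdn_trans p_dv_GM) ?indexgS ?joing_subr.
by [].
Qed.

Lemma mulG_AF_Hall : (A <*> 'F(G)) * Q = G.
Proof. exact: mulG_pHall pi_star_index_AF hallQ. Qed.

(** [C] remains a Hall subgroup in the larger [A 'F(G)], since ['F(G)]
    contributes only primes outside [pi_star]; the [pi_star]-subgroup on the
    left contains [C], so it cannot be larger. *)
Lemma setI_AF_Hall : (A <*> 'F(G)) :&: Q = C.
Proof.
have [sCA piC pi'AC] := and3P hallC; have [sQG piQ pi'GQ] := and3P hallQ.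
have sCM: C \subset A <*> 'F(G) by rewrite (subset_trans sCA) ?joing_subl.
have hallMC: pis.-Hall(A <*> 'F(G)) C.
  rewrite /pHall sCM piC -(Lagrange_index (joing_subl _ _) sCA) pnatM pi'AC andbT.
  rewrite index_joing_norm //; apply: pnat_dvd (dvdn_indexg _ _) _.
  apply: sub_in_pnat (pgroup_pi 'F(G)) => p _ piFp.
  by rewrite !inE negb_and piFp orbT.
apply: sub_pHall hallMC _ _ (subsetIl _ _).
  exact: pgroupS (subsetIr _ _) piQ.
by rewrite subsetI sCM.
Qed.

(** The subgroup ['F(G) Q] is a supplement of [A] in [G], hence all of [G]. *)
Lemma mulG_Fitting_Hall : 'F(G) * Q = G.
Proof.
have [sQG _ _] := and3P hallQ.
have nFQ: Q \subset 'N('F(G)) by rewrite (subset_trans sQG) ?gFnorm.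
rewrite -norm_joinEr //; apply: (mt_stabilizer_supplement mtA).
- by rewrite coreA sub1G.
- by rewrite join_subG Fitting_sub.
by rewrite /= norm_joinEr // mulgA -norm_joinEl ?mulG_AF_Hall.
Qed.

(** The bijection sends [C x] to [A 'F(G) x]. It is injective because [Q] meets
    [A 'F(G)] in [C] and onto because [A 'F(G) Q = G]. *)
Lemma rcosets_perm_equivalent :
  perm_equivalent 'Rs Q (rcosets C Q) 'Rs G (rcosets (A * 'F(G)) G).
Proof.
have [sCA _ _] := and3P hallC; have [sQG _ _] := and3P hallQ.
have sCM: C \subset A <*> 'F(G) by rewrite (subset_trans sCA) ?joing_subl.
rewrite -norm_joinEl //; set M := A <*> 'F(G) in sCM *.
have fE x: M * (C :* x) = M :* x by rewrite mulgA mulGSid.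
exists (fun X => M * X); split=> /=.
- move=> _ _ /rcosetsP[x Qx ->] /rcosetsP[y Qy ->]; rewrite !fE.
  move/rcoset_eqP; rewrite mem_rcoset => Mxy; apply/rcoset_eqP.
  by rewrite mem_rcoset -setI_AF_Hall inE Mxy groupM ?groupV.
- apply/setP=> X; apply/imsetP/rcosetsP=> [[_ /rcosetsP[x Qx ->] ->]|[g Gg ->]].
    by exists x; rewrite ?fE ?(subsetP sQG).
  have /mulsgP[m q Mm Qq ->]: g \in M * Q by rewrite mulG_AF_Hall.
  by exists (C :* q); rewrite ?mem_rcosets ?mulSGid // fE rcosetM rcoset_id.
- move=> q Qq; exists q; first exact: subsetP Qq.
  by move=> X _; rewrite /= !rcosetE mulgA.
(* Writing [g = u * q] with [u] in ['F(G)], the factor [u] moves past [x] as a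
   conjugate, which the coset absorbs. *)
move=> g; rewrite -{1}mulG_Fitting_Hall => /mulsgP[u q Fu Qq ->]; exists q => //.
move=> _ /rcosetsP[x Qx ->]; rewrite /= !rcosetE mulgA fE -!rcosetM.
have Mux: u ^ x^-1 \in M.
  rewrite (subsetP (joing_subr _ _)) // memJ_norm // groupV.
  exact: subsetP (subset_trans sQG (gFnorm _ _)) _ Qx.
have ->: x * (u * q) = u ^ x^-1 * (x * q).
  by rewrite conjgE invgK !mulgA mulgKV.
by rewrite [RHS]rcosetM (@rcoset_id _ (A <*> 'F(G))%G _ Mux).
Qed.

End ComplementAction.

End SquarefreeIndex.

Theorem theorem3p3 (gT : finGroupType) (G A : {group gT}) (n : nat)
    (solG : solvable G) (sAG : A \subset G)
    (coreA : gcore A G :=: 1) (mtA : mt_stabilizer G A)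
    (def_n : n = #|G : A|) (sqf_n : squarefree n) :
  [/\ coprime #|'F(G)| #|G : 'F(G)|,
      (forall (p : nat) (P : {group gT}),
          prime p -> p.-Sylow('F(G)) P -> p.-abelem P),
      (nilpotent G <-> [/\ cyclic G, #|G| = n & A :=: 1])
    & (forall C Q : {group gT},
          let pis := pi_star n #|'F(G)| in
          pis.-Hall(A) C -> pis.-Hall(G) Q -> C \subset Q ->
          #|Q : C| = n_star n #|'F(G)| /\
          perm_equivalent 'Rs Q (rcosets C Q)
                          'Rs G (rcosets (A * 'F(G)) G))].
Proof.
subst n; have hallF := Fitting_pHall sAG coreA sqf_n solG mtA.
split.
- by have /and3P[_ piF pi'GF] := hallF; apply: pnat_coprime pi'GF.
- exact: Fitting_Sylow_abelem sqf_n.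
- split=> [nilG | [cycG _ _]]; last exact/abelian_nil/cyclic_abelian.
  have [cycG A1] := nilpotent_cyclic sAG coreA sqf_n nilG.
  by rewrite A1 indexg1.
move=> C Q pis hallC hallQ sCQ; split; first exact: index_Hall_pi_star hallQ sCQ.
exact: rcosets_perm_equivalent hallQ sCQ.
Qed.
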